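(* Let $r\in\mathbb{N}$ ($r\ge 1$) and $p\in\mathbb{Z}$ be fixed. Let $k\ge 1$, let $s_1,\ldots,s_k$ be pairwise distinct positive integers and let $A_1,\ldots,A_k$ be positive integers. For $q\in\mathbb{N}$ put $x_+(q)=\frac{-p+\sqrt{p^2+4rq}}{2r}$. For $R\in\mathbb{N}$ let $P_R^{r,p}\binom{s_1,\ldots,s_k}{A_1,\ldots,A_k}$ be the probability, for $q$ chosen uniformly at random from $\{1,\ldots,R\}$, that $x_+(q)\in E\binom{s_1,\ldots,s_k}{A_1,\ldots,A_k}$, i.e. $$P_R^{r,p}\binom{s_1,\ldots,s_k}{A_1,\ldots,A_k}=\frac1R\,\#\Big\{q\in\{1,\ldots,R\}: x_+(q)\in E\tbinom{s_1,\ldots,s_k}{A_1,\ldots,A_k}\Big\}.$$ Then $$\lim_{R\to\infty}P_R^{r,p}\binom{s_1,\ldots,s_k}{A_1,\ldots,A_k}=\mu\binom{s_1,\ldots,s_k}{A_1,\ldots,A_k}.$$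
   Context: Every real number $x$ is written as a regular continued fraction $x=[a_0;a_1,a_2,\ldots]$ with $a_0\in\mathbb{Z}$ and $a_i\in\mathbb{N}$, $a_i\ge 1$, for $i\ge1$ (for rational $x$ the expansion is finite; take the standard one, in which the last partial quotient is at least $2$ unless $x$ is an integer). For pairwise distinct positive integers $s_1,\ldots,s_k$ and positive integers $A_1,\ldots,A_k$, $E\binom{s_1,\ldots,s_k}{A_1,\ldots,A_k}$ denotes the set of real numbers $x$ whose partial quotients satisfy $a_{s_1}=A_1,\ldots,a_{s_k}=A_k$ (in particular these partial quotients exist). $\mu\binom{s_1,\ldots,s_k}{A_1,\ldots,A_k}$ denotes the Lebesgue measure of $E\binom{s_1,\ldots,s_k}{A_1,\ldots,A_k}\cap[0,1)$. *)

(* Defs.v *)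
From HB Require Import structures.
From mathcomp Require Import all_boot all_order all_algebra.
From mathcomp Require Import all_classical all_reals all_analysis.

Set Implicit Arguments.
Unset Strict Implicit.
Unset Printing Implicit Defensive.

Import Order.TTheory GRing.Theory Num.Theory.
Import numFieldNormedType.Exports.

Local Open Scope classical_set_scope.
Local Open Scope ring_scope.

(* Complete quotients of the continued fraction algorithm: x_0 = x and         *)
(* x_(n+1) = 1 / (x_n - floor x_n), the process stopping (None) as soon as     *)
(* x_n is an integer. Stopping there selects, for rational x, the finite       *)
(* expansion whose last partial quotient is at least 2 (unless x is an         *)
(* integer).                                                                   *)
Fixpoint cf_complete (R : realType) (x : R) (n : nat) : option R :=
  if n is m.+1 then
    if cf_complete x m is Some y then
      let f := y - (Num.floor y)%:~R in
      if f == 0 then None else Some f^-1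
    else None
  else Some x.

Definition cf_quotient (R : realType) (x : R) (n : nat) : option int :=
  omap (fun y : R => Num.floor y) (cf_complete x n).

Definition cf_set (R : realType) (k : nat) (s A : 'I_k -> nat) : set R :=
  [set x | forall i : 'I_k, cf_quotient x (s i) = Some (A i)%:Z].

Definition cf_mu (R : realType) (k : nat) (s A : 'I_k -> nat) : \bar R :=
  @lebesgue_measure R (cf_set s A `&` `[0, 1[).

Definition xplus (R : realType) (r : nat) (p : int) (q : nat) : R :=
  (- p%:~R + Num.sqrt (p%:~R ^+ 2 + 4 * r%:R * q%:R)) / (2 * r%:R).

Definition cf_prob (R : realType) (r : nat) (p : int) (k : nat)
    (s A : 'I_k -> nat) (N : nat) : R :=
  (\sum_(1 <= q < N.+1 | xplus R r p q \in cf_set s A) 1)%N%:R / N%:R.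

(* Main.v *)
Require Import Defs.
From HB Require Import structures.
From mathcomp Require Import all_boot all_order all_algebra.
From mathcomp Require Import all_classical all_reals all_analysis measurable_realfun.
From mathcomp Require Import ring lra zify.

Set Implicit Arguments.
Unset Strict Implicit.
Unset Printing Implicit Defensive.

Import Order.TTheory GRing.Theory Num.Theory.
Import numFieldNormedType.Exports.

Local Open Scope classical_set_scope.
Local Open Scope ring_scope.

(* The set E of numbers with the prescribed partial quotients is invariant under
   integer translations and locally constant at every irrational point.  Hence
   the dyadic cells of [0, 1) that are contained neither in E nor in its
   complement have total length tending to 0: their unions decrease to a set of
   rationals.  It remains to see that each cell [a, b) asymptotically receives at
   least its share b - a of the fractional parts of x_+(q); applied to the cells
   inside E and to those inside the complement, this one-sided bound gives both
   inequalities.  For m large, m + a <= x_+(q) < m + b means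
   f(m + a) <= q < f(m + b) with f t = r t^2 + p t, so there are at least
   (b - a)(2 r m + O(1)) - 1 such q, and summing over m with f(m) <= N yields
   (b - a) N - O(sqrt N). *)

(** * Translation invariance and local constancy of the continued fraction sets *)

(** From the first step on, only the fractional part of [x] enters; the index starts at 1 because
    the complete quotient of index 0 is the number itself, which does shift. *)
Lemma cf_completeDz (R : realType) (x : R) (m : int) (n : nat) :
  cf_complete (x + m%:~R) n.+1 = cf_complete x n.+1.
Proof.
elim: n => [|n IH]; last first.
  by rewrite -[LHS]/(if cf_complete (x + m%:~R) n.+1 is Some y then _ else _) IH.
rewrite /= (addrC x) floorDzr ?intr_int// intrKfloor rmorphD/= opprD.
by rewrite addrACA subrr add0r.
Qed.

Lemma cf_setDz (R : realType) (k : nat) (s A : 'I_k -> nat) (x : R) (m : int) :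
  (forall i, (0 < s i)%N) -> cf_set s A (x + m%:~R) = cf_set s A x.
Proof.
move=> s_gt0; rewrite /cf_set /=; apply: eq_forall => i.
move: (s_gt0 i); rewrite /cf_quotient; case: (s i) => // n _.
by rewrite cf_completeDz.
Qed.

Lemma irrational_inv_sub (R : realType) (y : R) (m : int) :
  irrational y -> irrational (y - m%:~R)^-1.
Proof.
move=> yI [q _ qE]; apply: yI; exists (q^-1 + m%:~R) => //.
by rewrite rmorphD/= fmorphV ratr_int/= qE invrK subrK.
Qed.

(** The strict inequality records that fractional parts stay nonzero near [y], so that the continued
    fraction algorithm does not stop there. *)
Lemma floor_near_irrational (R : realType) (y : R) : irrational y ->
  \forall z \near y, Num.floor z = Num.floor y /\ (Num.floor y)%:~R < z.
Proof.
move=> yI.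
have fy : (Num.floor y)%:~R < y.
  rewrite lt_neqAle floor_le andbT; apply: contra_notN yI => /eqP <-.
  by exists (Num.floor y)%:~R => //; rewrite ratr_int.
near=> z; have zf : (Num.floor y)%:~R < z by near: z; exact: lt_nbhsr.
split=> //; apply: floor_def; rewrite (ltW zf)/=.
by near: z; apply: lt_nbhsl; exact: floorD1_gt.
Unshelve. all: by end_near. Qed.

(** Near [x] the first [n] floors keep their values at [x]. With these floors frozen, the complete
    quotient becomes a composition of translations and inversions, which is continuous at [x] and
    preserves irrationality. *)
Lemma cf_complete_near_irrational (R : realType) (x : R) (n : nat) :
  irrational x -> exists g : R -> R, [/\ {for x, continuous g},
    irrational (g x) & \forall z \near x, cf_complete z n = Some (g z)].
Proof.
move=> xI; elim: n => [|n [g [gc gI gE]]].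
  by exists id; split => //; near=> z.
(* The floor is taken at [g x] rather than at [g z]: this makes continuity immediate, and the two
   floors agree near [x]. *)
exists (fun z => (g z - (Num.floor (g x))%:~R)^-1).
have gfl := gc _ (floor_near_irrational gI).
have := nbhs_singleton gfl; rewrite /= => -[_ gx_gt].
split; last 1 first.
- near=> z; have zE : cf_complete z n = Some (g z) by near: z.
  have [flE z_gt] : Num.floor (g z) = Num.floor (g x) /\
      (Num.floor (g x))%:~R < g z.
    by near: z.
  by rewrite /= zE flE subr_eq0 gt_eqF.
- apply: cvgV; first by rewrite subr_eq0 gt_eqF.
  by apply: cvgB => //; exact: cvg_cst.
- exact: irrational_inv_sub.
Unshelve. all: by end_near. Qed.

Lemma cf_set_near_irrational (R : realType) (k : nat) (s A : 'I_k -> nat)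
    (x : R) :
  irrational x -> \forall z \near x, cf_set s A z = cf_set s A x.
Proof.
move=> xI.
have quotE (i : 'I_k) : \forall z \near x,
    cf_quotient z (s i) = cf_quotient x (s i).
  have [g [gc gI gE]] := cf_complete_near_irrational (s i) xI.
  have gfl := gc _ (floor_near_irrational gI).
  near=> z; rewrite /cf_quotient (nbhs_singleton gE) (near gE)//=; congr Some.
  by have [] : Num.floor (g z) = Num.floor (g x) /\
      (Num.floor (g x))%:~R < g z by near: z.
near=> z; rewrite /cf_set /=; apply: eq_forall => i; congr (_ = _).
by move: i; near: z; exact: filter_forall.
Unshelve. all: by end_near. Qed.

(** * Dyadic cells, and the vanishing measure of those that [E] cuts *)

Lemma countable_rational (R : realType) : countable (@rational R).
Proof. exact: card_le_trans (card_image_le _ _) (countableP _). Qed.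

Definition cell (R : realType) (D j : nat) : set R :=
  [set x | j%:R <= x * D%:R < j.+1%:R].

Arguments cell : clear implicits.

Lemma cell_itv (R : realType) (D j : nat) : (0 < D)%N ->
  cell R D j = `[j%:R / D%:R, j.+1%:R / D%:R[%classic.
Proof.
move=> D0; apply/seteqP; split=> x; rewrite /cell /= in_itv/=.
all: by rewrite ler_pdivrMr ?ltr_pdivlMr ?ltr0n.
Qed.

Lemma measurable_cell (R : realType) (D j : nat) : (0 < D)%N ->
  measurable (cell R D j).
Proof. by move=> D0; rewrite cell_itv//; exact: measurable_itv. Qed.

Lemma cell_inj (R : realType) (D i j : nat) (x : R) :
  cell R D i x -> cell R D j x -> i = j.
Proof.
move=> /andP[a b] /andP[c d].
have := le_lt_trans a d; have := le_lt_trans c b; rewrite !ltr_nat; lia.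
Qed.

Lemma lebesgue_measure_cells (R : realType) (D : nat) (P : pred 'I_D) :
  (0 < D)%N ->
  @lebesgue_measure R (\big[setU/set0]_(j < D | P j) cell R D j) =
  (#|P|%:R / D%:R)%:E.
Proof.
move=> D0; rewrite measure_bigsetU_ord => [|j|]; last 2 first.
- exact: measurable_cell.
- by move=> i j _ _ [x [/= a b]]; apply/val_inj; exact: cell_inj a b.
rewrite (eq_bigr (fun=> (D%:R^-1)%:E)) => [|j _].
  by rewrite sumEFin sumr_const mulr_natl.
rewrite /= cell_itv// lebesgue_measure_itv/= lte_fin.
have D0' : 0 < D%:R :> R by rewrite ltr0n.
rewrite ltr_pM2r ?invr_gt0// ltr_nat leqnn -EFinB; congr EFin.
by rewrite -mulrBl -natrB ?subSnn ?mul1r.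
Qed.

Lemma bigcells (R : realType) (D : nat) (P : pred 'I_D) (x : R) :
  (\big[setU/set0]_(j < D | P j) cell R D j) x <->
  exists2 j : 'I_D, P j & cell R D j x.
Proof.
split=> [|[j Pj xj]]; last by rewrite (bigD1 j)//=; left.
elim/big_ind: _ => [//|A B IA IB [/IA|/IB]//|j Pj xj]; by exists j.
Qed.

Definition decided (R : realType) (E : set R) (D j : nat) : Prop :=
  cell R D j `<=` E \/ cell R D j `<=` ~` E.

Lemma cell_divn (R : realType) (D d j : nat) : (0 < d)%N ->
  cell R (D * d) j `<=` cell R D (j %/ d).
Proof.
move=> d0 x /andP[a b]; have d0' : 0 < d%:R :> R by rewrite ltr0n.
rewrite /cell/= -(ler_pM2r d0') -(ltr_pM2r d0') -mulrA -!natrM.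
rewrite (le_trans _ a) ?ler_nat ?leq_divM//=.
by rewrite (lt_le_trans b)// ler_nat -ltn_divLR.
Qed.

Lemma decided_divn (R : realType) (E : set R) (D d j : nat) : (0 < d)%N ->
  decided E D (j %/ d) -> decided E (D * d) j.
Proof.
by move=> d0 [H|H]; [left|right]; apply: subset_trans H; exact: cell_divn.
Qed.

Definition undecided_set (R : realType) (E : set R) (n : nat) : set R :=
  \big[setU/set0]_(j < 2 ^ n | ~~ `[< decided E (2 ^ n) j >]) cell R (2 ^ n) j.

(** The cell of index [j] at level [m] lies in the cell of index [j %/ 2 ^ (m - n)] at level [n],
    and every subcell of a decided cell is decided. *)
Lemma undecided_set_nonincreasing (R : realType) (E : set R) (n m : nat) :
  (n <= m)%N -> undecided_set E m `<=` undecided_set E n.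
Proof.
move=> nm x /bigcells[j /asboolPn jU xj]; apply/bigcells.
have d0 : (0 < 2 ^ (m - n))%N by rewrite expn_gt0.
have mE : (2 ^ m = 2 ^ n * 2 ^ (m - n))%N by rewrite -expnD subnKC.
have jn : (j %/ 2 ^ (m - n) < 2 ^ n)%N by rewrite ltn_divLR// -mE.
exists (Ordinal jn) => /=.
  by apply/asboolPn => /(decided_divn d0); rewrite -mE.
by have := @cell_divn R (2 ^ n) _ j d0; rewrite -mE; apply.
Qed.

(** Around an irrational point [E] is constant on some ball, and a fine enough cell through the
    point fits into that ball and is therefore decided. *)
Lemma bigcap_undecided_set (R : realType) (E : set R) :
  (forall x, irrational x -> \forall z \near x, E z = E x) ->
  \bigcap_n undecided_set E n `<=` rational.
Proof.
move=> Eloc x xU; apply: contrapT => /Eloc /nbhs_ballP[e /= e0 xe].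
have [n ne] : exists n, 2 ^- n < e.
  have /cvgrPdist_lt/(_ _ e0)[n _ /(_ n (leqnn n))] : (2^-1 : R) ^+ n @[n --> \oo] --> 0.
    by apply: cvg_expr; rewrite ger0_norm//; lra.
  rewrite /= sub0r normrN exprVn ger0_norm ?invr_ge0 ?exprn_ge0// => ?.
  by exists n.
have /bigcells[j /asboolPn jU /andP[a b]] := xU n I.
(* Two points of the same cell are less than [2 ^- n] apart, hence less than [e]. *)
have sub z : cell R (2 ^ n) j z -> E z = E x.
  move=> /andP[c d]; apply: xe; rewrite /ball /=; apply: lt_trans ne.
  move: a b c d; rewrite !natrX -[j.+1]addn1 natrD.
  set t := 2 ^+ n; have t0 : 0 < t by exact: exprn_gt0.
  move=> a b c d; rewrite -[X in _ < X]mul1r ltr_pdivlMr//.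
  rewrite -[X in _ * X](gtr0_norm t0) -normrM mulrBl ltr_norml; lra.
apply: jU; have [Ex|Ex] := pselect (E x); [left|right] => z /sub /= zx; by rewrite zx.
Qed.

Lemma measurable_undecided_set (R : realType) (E : set R) (n : nat) :
  measurable (undecided_set E n).
Proof.
by apply: bigsetU_measurable => j _; apply: measurable_cell; rewrite expn_gt0.
Qed.

Lemma lebesgue_measure_undecided_set (R : realType) (E : set R) (n : nat) :
  @lebesgue_measure R (undecided_set E n) =
  (#|[pred j : 'I_(2 ^ n) | ~~ `[< decided E (2 ^ n) j >]]|%:R / (2 ^ n)%:R)%:E.
Proof.
rewrite -(@lebesgue_measure_cells R (2 ^ n)
  [pred j : 'I_(2 ^ n) | ~~ `[< decided E (2 ^ n) j >]])//.
by rewrite expn_gt0.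
Qed.

(** Continuity of the measure from above: the limit is the measure of the intersection, which is
    countable and hence null. *)
Lemma lebesgue_measure_undecided_cvg (R : realType) (E : set R) :
  (forall x, irrational x -> \forall z \near x, E z = E x) ->
  @lebesgue_measure R (undecided_set E n) @[n --> \oo] --> 0%E.
Proof.
move=> Eloc; have cU : countable (\bigcap_n undecided_set E n).
  apply: sub_countable (countable_rational R).
  exact: subset_card_le (bigcap_undecided_set Eloc).
rewrite -(countable_lebesgue_measure0 cU).
apply: nonincreasing_cvg_mu.
- by rewrite [ltLHS]lebesgue_measure_undecided_set ltry.
- exact: measurable_undecided_set.
- exact: countable_measurable cU.
- by move=> n m nm; apply/subsetPset; exact: undecided_set_nonincreasing.
Qed.

(** A point of [E] outside the interior must be rational, so [E] is an open set together with a
    countable one. *)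
Lemma measurable_locally_constant_irrational (R : realType) (E : set R) :
  (forall x, irrational x -> \forall z \near x, E z = E x) -> measurable E.
Proof.
move=> Eloc.
have -> : E = interior E `|` (E `\` interior E).
  by rewrite setDUK//; exact: interior_subset.
apply: measurableU; first by apply: open_measurable; exact: open_interior.
apply: countable_measurable => //; apply: sub_countable (countable_rational R).
apply: subset_card_le => x [Ex nx]; apply: contrapT => /Eloc xE; apply: nx.
by apply: filterS xE => z ->.
Qed.

(** * Counting the [q] for which [xplus R r p q] falls in a given cell modulo 1 *)

(** The integers of [[x, y)] run from the ceiling of [x] up to, but excluding, that of [y]; rounding
    costs less than 1. *)
Lemma count_nat_itv (R : realType) (x y : R) (m n : nat) (P : pred nat) :
  m%:R <= x -> y <= n%:R -> (forall q, x <= q%:R < y -> P q) ->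
  y - x - 1 <= (\sum_(m <= q < n | P q) 1)%N%:R.
Proof.
move=> mx yn PP; have [yx|xy] := leP y x.
  by apply: le_trans (ler0n _ _); lra.
have x0 : 0 <= x by apply: le_trans mx; exact: ler0n.
(* Both endpoints are nonnegative when [x < y], since [m] is a natural number below [x]; absolute
   values of ceilings are thus harmless. *)
have absE (z : R) : 0 <= z -> `|Num.ceil z|%N%:R = (Num.ceil z)%:~R :> R.
  move=> z0; have cz : 0 <= Num.ceil z by rewrite ceil_ge0; lra.
  by rewrite natr_absz ger0_norm.
have := absE x x0; have := absE y (le_trans x0 (ltW xy)).
have /andP[] := ceil_itv x; have /andP[] := ceil_itv y; rewrite !rmorphB/=.
set a := `|Num.ceil x|%N; set b := `|Num.ceil y|%N.
move=> y1 y2 x1 x2 bE aE; rewrite -bE in y1 y2; rewrite -aE in x1 x2.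
have ab : (a <= b)%N by rewrite -(ler_nat R) bE aE ler_int le_ceil// ltW.
have ma : (m <= a)%N by rewrite -(ler_nat R) (le_trans mx).
have bn : (b <= n)%N.
  by rewrite -ltnS -(ltr_nat R) -[n.+1]addn1 natrD; lra.
have -> : (\sum_(m <= q < n | P q) 1 = \sum_(m <= q < a | P q) 1 +
    (\sum_(a <= q < b | P q) 1 + \sum_(b <= q < n | P q) 1))%N.
  by rewrite -!big_cat_nat// (leq_trans ab).
have -> : (\sum_(a <= q < b | P q) 1 = b - a)%N.
  rewrite big_nat_cond (eq_bigl (fun q => (a <= q < b)%N && true)).
    by rewrite -big_nat_cond sum_nat_const_nat muln1.
  move=> q; rewrite andbT; apply: andb_idr => /andP[aq qb]; apply: PP.
  have qb' : q.+1%:R <= b%:R :> R by rewrite ler_nat.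
  have aq' : a%:R <= q%:R :> R by rewrite ler_nat.
  by move: qb'; rewrite -addn1 natrD => qb'; apply/andP; split; lra.
rewrite !natrD natrB//.
have := ler0n R (\sum_(m <= q < a | P q) 1).
have := ler0n R (\sum_(b <= q < n | P q) 1).
lra.
Qed.

(** [xplus R r p q] is the larger root of [r t^2 + p t = q]. The hypothesis places [t] to the right
    of the vertex, so that squaring [2 r t + p] preserves the order. *)
Lemma xplus_ge (R : realType) (r : nat) (p : int) (q : nat) (t : R) :
  (0 < r)%N -> 0 <= 2 * r%:R * t + p%:~R ->
  (t <= xplus R r p q) = (r%:R * t ^+ 2 + p%:~R * t <= q%:R).
Proof.
move=> r0 t0; have r0' : 0 < r%:R :> R by rewrite ltr0n.
have D0 : 0 <= p%:~R ^+ 2 + 4 * r%:R * q%:R :> R.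
  by rewrite addr_ge0 ?sqr_ge0// mulr_ge0// mulr_ge0// ltW.
have r4 : 0 < 4 * r%:R :> R by rewrite mulr_gt0.
rewrite /xplus ler_pdivlMr ?mulr_gt0// addrC lerBrDr.
have -> : t * (2 * r%:R) + p%:~R = Num.sqrt ((2 * r%:R * t + p%:~R) ^+ 2).
  by rewrite sqrtr_sqr ger0_norm// mulrC.
rewrite ler_sqrt// -[RHS](ler_pM2l r4) -[RHS](lerD2l (p%:~R ^+ 2)).
by congr (_ <= _); ring.
Qed.

(** The main term uses [2 m + 1] because it is the increment of [m ^ 2], so that a sum over [m]
    telescopes. The loss [r + |p|] absorbs the position of the cell and the linear term of the
    quadratic, and the extra 1 is the rounding loss. *)
Lemma count_cell_step (R : realType) (r : nat) (p : int) (D j m : nat)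
    (P : pred nat) (a b : nat) :
  (0 < r)%N -> (j < D)%N -> (`|p| <= m)%N ->
  (forall q, cell R D j (xplus R r p q - m%:R) -> P q) ->
  a%:R = r%:R * m%:R ^+ 2 + p%:~R * m%:R :> R ->
  b%:R = r%:R * m.+1%:R ^+ 2 + p%:~R * m.+1%:R :> R ->
  D%:R^-1 * (r%:R * (2 * m%:R + 1)) - (r + `|p| + 1)%:R <=
  (\sum_(a <= q < b | P q) 1)%N%:R :> R.
Proof.
move=> r0 jD pm PP aE bE.
have r1 : 1 <= r%:R :> R by rewrite ler1n.
have D0 : 0 < D%:R :> R by rewrite ltr0n (leq_ltn_trans _ jD).
have pm' : `|p|%N%:R <= m%:R :> R by rewrite ler_nat.
have [pl pu] : - `|p|%N%:R <= p%:~R :> R /\ p%:~R <= `|p|%N%:R :> R.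
  by apply/andP; rewrite natr_absz -ler_norml intr_norm.
move: pl pu pm'; rewrite !natrD; set b' := `|p|%N%:R => pl pu pm'.
have b0 : 0 <= b' by exact: ler0n.
set d := D%:R^-1; have d0 : 0 < d by rewrite invr_gt0.
have d1 : d <= 1 by rewrite invf_le1// ler1n (leq_ltn_trans _ jD).
have dD : d * D%:R = 1 by rewrite mulVf// gt_eqF.
set u := j%:R * d; have u0 : 0 <= u by rewrite mulr_ge0// ltW.
have u1 : u + d <= 1.
  by rewrite -(ler_pM2r D0) mulrDl /u -mulrA dD mulr1 mul1r natr1 ler_nat.
set f := fun t : R => r%:R * t ^+ 2 + p%:~R * t.
(* As [s] and [t] are at least [m >= |p|] and [r >= 1], the factor [r (s + t) + p] below is
   nonnegative. *)
have f_incr s t : m%:R <= s -> s <= t -> f s <= f t.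
  move=> ms st; rewrite -subr_ge0.
  have -> : f t - f s = (t - s) * (r%:R * (s + t) + p%:~R) by rewrite /f; ring.
  by apply: mulr_ge0; nra.
have mono := @count_nat_itv R (f (m%:R + u)) (f (m%:R + u + d)) a b P.
apply: le_trans (mono _ _ _).
- have -> : f (m%:R + u + d) - f (m%:R + u) = d * (r%:R * (2 * m%:R + 2 * u + d) + p%:~R).
    by rewrite /f; ring.
  have w0 : 0 <= r%:R * (2 * u + d) by apply: mulr_ge0; lra.
  have w1 : 0 <= d * (r%:R * (2 * u + d) + (p%:~R + b')).
    by apply: mulr_ge0; lra.
  have w2 : 0 <= (1 - d) * (r%:R + b') by apply: mulr_ge0; lra.
  lra.
- by rewrite aE -/(f _); apply: f_incr; lra.
- by rewrite bE -/(f _) -natr1; apply: f_incr; lra.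
move=> q /andP[q1 q2]; apply: PP.
have q1' : m%:R + u <= xplus R r p q by rewrite xplus_ge// -/b'; nra.
have q2' : xplus R r p q < m%:R + u + d.
  by rewrite ltNge xplus_ge// -?ltNge -/b'//; nra.
rewrite /cell/=; rewrite -natr1.
have -> : j%:R = u * D%:R by rewrite /u -mulrA dD mulr1.
have -> : u * D%:R + 1 = (u + d) * D%:R by rewrite mulrDl dD.
rewrite ler_pM2r// ltr_pM2r//; apply/andP; split; lra.
Qed.

(* The absolute value is harmless only for m >= |p|, see [quadz]. *)
Definition quad (r : nat) (p : int) (m : nat) : nat :=
  absz (r%:Z * m%:Z ^+ 2 + p * m%:Z)%R.

Lemma quadz (r : nat) (p : int) (m : nat) : (0 < r)%N -> (`|p| <= m)%N ->
  (quad r p m)%:Z = m%:Z * (r%:Z * m%:Z + p).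
Proof.
move=> r0 pm; rewrite /quad gez0_abs; first by ring.
have -> : r%:Z * m%:Z ^+ 2 + p * m%:Z = m%:Z * (r%:Z * m%:Z + p) by ring.
by apply: mulr_ge0 => //; nia.
Qed.

Lemma quadE (R : realType) (r : nat) (p : int) (m : nat) :
  (0 < r)%N -> (`|p| <= m)%N ->
  (quad r p m)%:R = r%:R * m%:R ^+ 2 + p%:~R * m%:R :> R.
Proof.
move=> r0 pm; rewrite -[LHS]/((quad r p m)%:Z%:~R) quadz//.
by rewrite rmorphM rmorphD rmorphM/=; ring.
Qed.

(** The strict bound on [|p|] makes the factor [r * m + p] at least 1. *)
Lemma quad_ge (r : nat) (p : int) (m : nat) :
  (0 < r)%N -> (`|p| < m)%N -> (m <= quad r p m)%N.
Proof.
move=> r0 pm; have qE := quadz r0 (ltnW pm).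
have : 1 <= r%:Z * m%:Z + p by nia.
rewrite -lez_nat qE; nia.
Qed.

Lemma quad_homo (r : nat) (p : int) (m : nat) :
  (0 < r)%N -> (`|p| < m)%N -> (quad r p m <= quad r p m.+1)%N.
Proof.
move=> r0 pm; have pm' : (`|p| <= m)%N := ltnW pm.
rewrite -lez_nat !quadz ?leqW//.
have : 1 <= r%:Z * m%:Z + p by nia.
nia.
Qed.

(** Induction on [M], starting at [|p| + 1]: the constant [r (|p| + 1)^2] makes the left-hand side
    nonpositive there, so nothing has to be counted before the quadratic becomes monotone. *)
Lemma count_cell_quad (R : realType) (r : nat) (p : int) (D j M : nat)
    (P : pred nat) :
  (0 < r)%N -> (j < D)%N -> (`|p| < M)%N ->
  (forall q m, cell R D j (xplus R r p q - m%:R) -> P q) ->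
  D%:R^-1 * (r%:R * M%:R ^+ 2) - (r + `|p| + 1)%:R * M%:R
    - r%:R * (`|p|.+1)%:R ^+ 2 <=
  (\sum_(1 <= q < quad r p M | P q) 1)%N%:R :> R.
Proof.
move=> r0 jD + PP; elim: M => // M IH; rewrite ltnS leq_eqVlt => /orP[/eqP <-|pM].
  apply: le_trans (ler0n _ _); rewrite -addrA -opprD subr_le0 -[leLHS]addr0 [leRHS]addrC.
  apply: lerD; last by rewrite mulr_ge0.
  have D0 : (0 < D)%N by exact: leq_ltn_trans jD.
  by rewrite ler_piMl ?mulr_ge0 ?exprn_ge0// invf_le1 ?ltr0n// ler1n.
rewrite (@big_cat_nat _ _ _ (quad r p M)) /=; last 2 first.
- by apply: leq_trans (quad_ge r0 pM); exact: leq_ltn_trans pM.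
- exact: quad_homo.
have := @count_cell_step R r p D j M P (quad r p M) (quad r p M.+1) r0 jD (ltnW pM) (PP^~ M).
rewrite !quadE ?(leqW (ltnW pM)) ?(ltnW pM)//.
move=> /(_ erefl erefl) step; have {}IH := IH pM.
rewrite [leRHS]natrD; apply: le_trans (lerD IH step); rewrite -natr1.
by rewrite le_eqVlt; apply/orP; left; apply/eqP; ring.
Qed.

(** The largest [M] with [quad r p M <= N] works; it exists because [quad r p M] is at least [M]. *)
Lemma exists_quad_bracket (r : nat) (p : int) (M1 N : nat) :
  (0 < r)%N -> (`|p| < M1)%N -> (quad r p M1 <= N)%N ->
  exists2 M, (M1 <= M)%N & (quad r p M <= N < quad r p M.+1)%N.
Proof.
move=> r0 pM1 M1N.
have ex : exists M, (M1 <= M)%N && (quad r p M <= N)%N.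
  by exists M1; rewrite leqnn.
have ub M : (M1 <= M)%N && (quad r p M <= N)%N -> (M <= N)%N.
  move=> /andP[M1M]; apply: leq_trans; apply: quad_ge => //.
  exact: leq_trans M1M.
case: (ex_maxnP ex ub) => M /andP[M1M MN] Mmax; exists M => //.
rewrite MN ltnNge; apply/negP => MN'.
by have := Mmax M.+1; rewrite MN' (leq_trans M1M)// ltnn => /(_ isT).
Qed.

Lemma count_cell (R : realType) (r : nat) (p : int) (D j : nat)
    (P : pred nat) (e : R) :
  (0 < r)%N -> (j < D)%N -> 0 < e ->
  (forall q m, cell R D j (xplus R r p q - m%:R) -> P q) ->
  \forall N \near \oo,
    (D%:R^-1 - e) * N%:R <= (\sum_(1 <= q < N.+1 | P q) 1)%N%:R.
Proof.
move=> r0 jD e0 PP.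
have r1 : 1 <= r%:R :> R by rewrite ler1n.
have D0 : 0 < D%:R :> R by rewrite ltr0n (leq_ltn_trans _ jD).
(* [K] adds up all error coefficients: the losses of the single steps, the gap between [N] and
   [r M^2] caused by [N < quad r p M.+1], and the constant of [count_cell_quad]. Constant terms are
   bounded by multiples of [M >= 1]. *)
pose K : R := (r + `|p| + 1)%:R + 2 * r%:R + `|p|%N%:R
  + (r%:R + `|p|%N%:R + r%:R * (`|p|.+1)%:R ^+ 2).
(* Beyond [M1], [K <= e (M - |p|)]; multiplied by [M], the right-hand side is at most
   [e (r M^2 + p M) <= e N]. *)
pose M1 := (`|p|.+1 + `|Num.ceil (K / e)|)%N.
have pM1 : (`|p| < M1)%N by rewrite /M1 addSn ltnS leq_addr.
near=> N.
have M1N : (quad r p M1 <= N)%N by near: N; exact: nbhs_infty_ge.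
have [M M1M /andP[MN NM]] := exists_quad_bracket r0 pM1 M1N.
have pM : (`|p| < M)%N by exact: leq_trans M1M.
have C1 := count_cell_quad r0 jD pM PP.
have {C1} : D%:R^-1 * (r%:R * M%:R ^+ 2) - (r + `|p| + 1)%:R * M%:R
    - r%:R * (`|p|.+1)%:R ^+ 2 <= (\sum_(1 <= q < N.+1 | P q) 1)%N%:R :> R.
  apply: (le_trans C1); rewrite ler_nat [leqRHS](@big_cat_nat _ _ _ (quad r p M))//=.
  - exact: leq_addr.
  - by apply: leq_trans (quad_ge r0 pM); exact: leq_ltn_trans pM.
  - exact: leqW.
apply: le_trans.
have MK : K <= e * (M%:R - `|p|%N%:R).
  rewrite mulrC -ler_pdivrMr//.
  have h1 : K / e <= `|Num.ceil (K / e)|%N%:R.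
    by rewrite natr_absz (le_trans (ceil_ge _))// ler_int ler_norm.
  have : M1%:R <= M%:R :> R by rewrite ler_nat.
  rewrite /M1 natrD -natr1; lra.
have [pl pu] : - `|p|%N%:R <= p%:~R :> R /\ p%:~R <= `|p|%N%:R :> R.
  by apply/andP; rewrite natr_absz -ler_norml intr_norm.
have MN' : r%:R * M%:R ^+ 2 + p%:~R * M%:R <= N%:R :> R.
  by rewrite -quadE ?ler_nat ?(ltnW pM).
have NM' : N%:R <= r%:R * (M%:R + 1) ^+ 2 + p%:~R * (M%:R + 1) :> R.
  by rewrite natr1 -quadE ?ler_nat ?(ltnW NM) ?(leqW (ltnW pM)).
have m1 : 1 <= M%:R :> R by rewrite ler1n (leq_ltn_trans _ pM).
move: pl pu MK; rewrite /K; set b := `|p|%N%:R => pl pu MK.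
have b0 : 0 <= b by exact: ler0n.
set d := D%:R^-1; have d0 : 0 < d by rewrite invr_gt0.
have d1 : d <= 1 by rewrite invf_le1// ler1n (leq_ltn_trans _ jD).
have c0 : 0 <= r%:R * (`|p|.+1)%:R ^+ 2 :> R by rewrite mulr_ge0 ?exprn_ge0.
move: MK c0; set c := r%:R * (`|p|.+1)%:R ^+ 2; set C := (r + `|p| + 1)%:R.
move: MN' NM'; set x := N%:R; set m := M%:R; set s := r%:R; move=> MN' NM' MK c0.
have s1 : 1 <= s by [].
have m0 : 0 <= m by lra.
have k1 : (C + 2 * s + b + (s + b + c)) * m <= e * (m - b) * m by rewrite ler_wpM2r.
have k2 : e * (m - b) * m <= e * x.
  rewrite -mulrA ler_wpM2l// ?(ltW e0)//; apply: le_trans MN'.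
  have u1 : 0 <= (s - 1) * m ^+ 2 by rewrite mulr_ge0 ?sqr_ge0//; lra.
  have u2 : 0 <= (p%:~R + b) * m by rewrite mulr_ge0//; lra.
  lra.
have k3 : d * x <= d * (s * m ^+ 2) + ((2 * s + b) * m + (s + b)).
  have u1 : 0 <= (b - p%:~R) * (m + 1) by apply: mulr_ge0; lra.
  have u2 : x <= s * m ^+ 2 + ((2 * s + b) * m + (s + b)) by lra.
  apply: (le_trans (ler_wpM2l (ltW d0) u2)); rewrite mulrDr lerD2l ler_piMl//.
  by rewrite addr_ge0 ?mulr_ge0//; lra.
have k4 : s + b + c <= (s + b + c) * m by rewrite ler_peMr//; lra.
lra.
Unshelve. all: by end_near. Qed.

(** * Adding up disjoint cells and squeezing the frequency *)

(** A cell of index below [D] lies in [[0, 1)], so the integer subtracted from [x] must be its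
    floor, and then the cell is unique. *)
Lemma cell_sub_inj (R : realType) (D i j m n : nat) (x : R) :
  (i < D)%N -> (j < D)%N ->
  cell R D i (x - m%:R) -> cell R D j (x - n%:R) -> i = j.
Proof.
move=> iD jD xi xj.
have fl k l : (k < D)%N -> cell R D k (x - l%:R) -> Num.floor x = l%:Z.
  move=> kD /andP[a b]; have D0 : 0 < D%:R :> R by rewrite ltr0n (leq_ltn_trans _ kD).
  apply: floor_def; apply/andP; split.
    by rewrite -subr_ge0 -(pmulr_lge0 _ D0); apply: le_trans a.
  rewrite rmorphD/= -ltrBlDl -(ltr_pM2r D0) mul1r; apply: (lt_le_trans b).
  by rewrite ler_nat.
have [mn] : m%:Z = n%:Z by rewrite -(fl _ _ iD xi) (fl _ _ jD xj).
by rewrite mn in xi; exact: cell_inj xi xj.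
Qed.

Lemma count_cells (R : realType) (r : nat) (p : int) (D : nat)
    (P : pred 'I_D) (W : pred nat) (e : R) :
  (0 < r)%N -> (0 < D)%N -> 0 < e ->
  (forall (j : 'I_D) q m, P j -> cell R D j (xplus R r p q - m%:R) -> W q) ->
  \forall N \near \oo,
    (#|P|%:R / D%:R - e) * N%:R <= (\sum_(1 <= q < N.+1 | W q) 1)%N%:R.
Proof.
move=> r0 D0 e0 PW.
pose V (j : 'I_D) q := `[< exists m : nat, cell R D j (xplus R r p q - m%:R) >].
have D0' : 0 < D%:R :> R by rewrite ltr0n.
(* The error is shared out equally, since at most [D] cells are summed. *)
have eD0 : 0 < e / D%:R by exact: divr_gt0.
have Vj (j : 'I_D) : \forall N \near \oo,
    (D%:R^-1 - e / D%:R) * N%:R <= (\sum_(1 <= q < N.+1 | V j q) 1)%N%:R.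
  by apply: (@count_cell R r p D j _ _ r0 (ltn_ord j) eD0) => q m xq; apply/asboolP; exists m.
near=> N.
have VjN (j : 'I_D) : (D%:R^-1 - e / D%:R) * N%:R <=
    (\sum_(1 <= q < N.+1 | V j q) 1)%N%:R.
  by move: j; near: N; exact: filter_forall.
have VW : (\sum_(j | P j) \sum_(1 <= q < N.+1 | V j q) 1 <=
    \sum_(1 <= q < N.+1 | W q) 1)%N.
  (* After exchanging the sums, each [q] contributes to at most one cell, and it satisfies [W] if it
     contributes at all. *)
  under eq_bigr do rewrite big_mkcond/=.
  rewrite exchange_big [leqRHS]big_mkcond/=; apply: leq_sum => q _.
  have [[j Pj Vjq]|nV] := pselect (exists2 j, P j & V j q); last first.
    by rewrite big1// => j Pj; case: ifP => // Vjq; exfalso; apply: nV; exists j.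
  have /asboolP[m xj] := Vjq; rewrite (PW _ _ _ Pj xj) (bigD1 j)//= Vjq.
  rewrite big1 ?addn0// => i /andP[_ ij]; case: ifP => // /asboolP[n xi].
  by case/eqP: ij; apply/val_inj; exact: cell_sub_inj xi xj.
move: VW; rewrite -(ler_nat R) natr_sum; apply: le_trans.
apply: le_trans (ler_sum _ (fun j _ => VjN j)); rewrite sumr_const -[leRHS]mulr_natl.
rewrite mulrA ler_wpM2r//.
rewrite mulrBr lerB// -[leRHS]mulr1 mulrCA ler_wpM2l ?(ltW e0)//.
by rewrite ler_pdivrMr// mul1r ler_nat -[X in (_ <= X)%N]card_ord max_card.
Unshelve. all: by end_near. Qed.

Lemma exists_cell (R : realType) (D : nat) (x : R) : (0 < D)%N ->
  0 <= x < 1 -> exists j : 'I_D, cell R D j x.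
Proof.
move=> D0 /andP[x0 x1]; have D0' : 0 < D%:R :> R by rewrite ltr0n.
have xD0 : 0 <= x * D%:R by rewrite mulr_ge0.
have /andP[a b] := truncn_itv xD0.
have jD : (Num.truncn (x * D%:R) < D)%N.
  by rewrite -(ltr_nat R) (le_lt_trans a)// -[ltRHS]mul1r ltr_pM2r.
by exists (Ordinal jD); rewrite /cell/= a b.
Qed.

Lemma cell_sub01 (R : realType) (D : nat) (j : 'I_D) :
  cell R D j `<=` `[0, 1[%classic.
Proof.
move=> x /andP[a b]; have D0 : 0 < D%:R :> R.
  by rewrite ltr0n (leq_ltn_trans _ (ltn_ord j)).
rewrite /= in_itv/= -(pmulr_lge0 _ D0) (le_trans _ a)//=.
by rewrite -(ltr_pM2r D0) mul1r (lt_le_trans b)// ler_nat.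
Qed.

(* [E] is squeezed between the union of the cells contained in it and the
   complement of the union of the cells disjoint from it. *)
Lemma equidistribution_xplus (R : realType) (r : nat) (p : int) (E : set R) :
  (0 < r)%N -> (forall x (m : int), E (x + m%:~R) = E x) ->
  (forall x, irrational x -> \forall z \near x, E z = E x) ->
  ((\sum_(1 <= q < N.+1 | xplus R r p q \in E) 1)%N%:R / N%:R)%:E @[N --> \oo]
    --> @lebesgue_measure R (E `&` `[0, 1[).
Proof.
move=> r0 Eper Eloc.
have mE : measurable (E `&` `[0, 1[%classic).
  by apply: measurableI => //; exact: measurable_locally_constant_irrational.
have fE : lebesgue_measure (E `&` `[0, 1[%classic) \is a fin_num.
  rewrite ge0_fin_numE//; apply: (@le_lt_trans _ _ (lebesgue_measure `[0%R, 1%R[%classic)).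
    by apply: le_measure; rewrite ?inE//; exact: subIsetr.
  by rewrite lebesgue_measure_itv/= lte_fin ltr01 -EFinB ltry.
rewrite -(fineK fE); set mu := fine _.
apply: cvg_EFin; first by near=> N.
apply/cvgrPdist_lt => e e0.
have e4 : 0 < e / 4 by lra.
have [n un] : exists n, (lebesgue_measure (undecided_set E n) < (e / 4)%:E)%E.
  have nb : nbhs 0%E [set y : \bar R | (y < (e / 4)%:E)%E].
    by apply: open_nbhs_nbhs; split; [exact: open_ereal_lt_ereal|rewrite /= lte_fin].
  have [n _ /(_ n (leqnn n)) un] := lebesgue_measure_undecided_cvg Eloc nb.
  by exists n.
move: un; rewrite lebesgue_measure_undecided_set lte_fin.
set D := (2 ^ n)%N; have D0 : (0 < D)%N by rewrite expn_gt0.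
pose Pin := [pred j : 'I_D | `[< cell R D j `<=` E >]].
pose Pout := [pred j : 'I_D | `[< cell R D j `<=` ~` E >]].
set Pun := [pred j : 'I_D | _] => un.
have D0' : 0 < D%:R :> R by rewrite ltr0n.
(* A cell is nonempty, as it contains its left endpoint, so it cannot lie both in [E] and in the
   complement; exactly one of the three cases holds. *)
have cover (j : 'I_D) : (Pin j + Pout j + Pun j)%N = 1%N.
  have [x xj] : exists x, cell R D j x.
    exists (j%:R / D%:R); rewrite /cell/= divfK ?gt_eqF// lexx/= ltr_nat//.
  rewrite /Pun /=; case: (pselect (cell R D j `<=` E)) => [jE|jE].
    rewrite (asboolT jE) asboolF => [|jE']; last exact: jE' xj (jE _ xj).
    by rewrite asboolT//; left.
  rewrite (asboolF jE); case: (pselect (cell R D j `<=` ~` E)) => jE'.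
    by rewrite (asboolT jE') asboolT//; right.
  by rewrite (asboolF jE') asboolF// => -[].
have card_cover : #|Pin|%:R / D%:R + #|Pout|%:R / D%:R + #|Pun|%:R / D%:R = 1 :> R.
  rewrite -!mulrDl -!natrD -!sum1_card !(big_mkcond (fun j => j \in _))/=.
  rewrite -!big_split/= (eq_bigr (fun=> 1%N)) => [|j _].
    by rewrite sum1_card card_ord divff ?gt_eqF.
  exact: cover j.
have mcells (P : pred 'I_D) : measurable (\big[setU/set0]_(j < D | P j) cell R D j).
  by apply: bigsetU_measurable => j _; exact: measurable_cell.
have lower : #|Pin|%:R / D%:R <= mu.
  rewrite -lee_fin fineK// -lebesgue_measure_cells//.
  apply: le_measure; [exact: mem_set (mcells Pin)|exact: mem_set|].
  move=> x /bigcells[j /asboolP jE xj].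
  by split; [exact: jE|exact: cell_sub01 xj].
have upper : mu <= 1 - #|Pout|%:R / D%:R.
  have -> : 1 - #|Pout|%:R / D%:R = #|predC Pout|%:R / D%:R :> R.
    apply/eqP; rewrite subr_eq -mulrDl -natrD addnC cardC card_ord.
    by rewrite divff ?(gt_eqF D0').
  rewrite -lee_fin fineK// -lebesgue_measure_cells//.
  apply: le_measure; [exact: mem_set|exact: mem_set (mcells (predC Pout))|move=> x [Ex x01]].
  have [j xj] := exists_cell D0 x01.
  by apply/bigcells; exists j => //=; apply/asboolPn => /(_ _ xj).
have cin : \forall N \near \oo, (#|Pin|%:R / D%:R - e / 4) * N%:R <=
    (\sum_(1 <= q < N.+1 | xplus R r p q \in E) 1)%N%:R.
  apply: (@count_cells R r p D Pin _ _ r0 D0 e4) => j q m /asboolP jE /jE.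
  by rewrite inE -[m%:R]/((m%:Z)%:~R) -rmorphN/= Eper.
(* A lower bound for the complement serves as the upper bound for [E], because the two counts add up
   to [N]. *)
have cout : \forall N \near \oo, (#|Pout|%:R / D%:R - e / 4) * N%:R <=
    (\sum_(1 <= q < N.+1 | xplus R r p q \notin E) 1)%N%:R.
  apply: (@count_cells R r p D Pout _ _ r0 D0 e4) => j q m /asboolP jE /jE.
  by rewrite notin_setE -[m%:R]/((m%:Z)%:~R) -rmorphN/= Eper.
near=> N.
have N0 : 0 < N%:R :> R by rewrite ltr0n; near: N; exact: nbhs_infty_gt.
have cinN : (#|Pin|%:R / D%:R - e / 4) * N%:R <=
    (\sum_(1 <= q < N.+1 | xplus R r p q \in E) 1)%N%:R by near: N.
have coutN : (#|Pout|%:R / D%:R - e / 4) * N%:R <=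
    (\sum_(1 <= q < N.+1 | xplus R r p q \notin E) 1)%N%:R by near: N.
have total : (\sum_(1 <= q < N.+1 | xplus R r p q \in E) 1)%N%:R +
    (\sum_(1 <= q < N.+1 | xplus R r p q \notin E) 1)%N%:R = N%:R :> R.
  rewrite -natrD; congr (_%:R).
  by rewrite -(bigID (fun q => xplus R r p q \in E) xpredT (fun=> 1%N)) sum_nat_const_nat muln1 subn1.
move: cinN coutN total; rewrite -!ler_pdivlMr//=.
set x := (\sum_(1 <= q < N.+1 | xplus R r p q \in E) 1)%N.
set y := (\sum_(1 <= q < N.+1 | xplus R r p q \notin E) 1)%N.
move=> cinN coutN total.
have xy1 : x%:R / N%:R + y%:R / N%:R = 1 :> R.
  by rewrite -mulrDl total divff ?gt_eqF.
(* Both [mu] and the frequency lie, up to [e / 4], between the share of [Pin] and 1 minus the share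
   of [Pout]; these bounds differ by the share of [Pun], which is below [e / 4]. *)
rewrite ltr_norml; apply/andP; split; lra.
Unshelve. all: by end_near. Qed.

(** Positivity of the [s i] excludes the integer part [a_0], the only partial quotient that an
    integer translation changes; this gives the periodicity required for equidistribution. *)
Theorem theorem1 (R : realType) (r : nat) (hr : (0 < r)%N) (p : int)
    (k : nat) (hk : (0 < k)%N) (s A : 'I_k -> nat)
    (hs : forall i, (0 < s i)%N) (s_inj : injective s)
    (hA : forall i, (0 < A i)%N) :
  (cf_prob R r p s A N)%:E @[N --> \oo] --> cf_mu R s A.
Proof.
apply: equidistribution_xplus => // [x m|x xI]; first exact: cf_setDz.
exact: cf_set_near_irrational.
Qed.
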